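(* Let $(G;s,t)$ be a finite (oriented or unoriented) graph $G=(V,E)$ with source vertex $s$ and sink vertex $t$. Given a continuous family of weights $w_{i,\tau}$ on the edges $e_i\in E$ of $G$, depending on a parameter $\tau$, let $K_\tau$ be the convex set of max flow solutions from $s$ to $t$ for the weights at parameter value $\tau$. Then $K_\tau$ evolves (Lipschitz) continuously in the Hausdorff topology on closed subsets of Euclidean space.
   Context: The parameter $\tau$ may range over any reasonable space; for notational convenience take $\tau\in\mathbb{R}$. Each edge $e$ of an oriented graph carries a weight (capacity) $w(e)\in[0,\infty)$. A flow assigns to each edge a number $f(e)\in[0,\infty)$ subject to (1) the capacity constraint $f(e)\le w(e)$ for every edge $e$, and (2) zero divergence: for every vertex $v\in V$ with $v\ne s,t$, $\sum_{e\text{ into }v}f(e)=\sum_{e\text{ out of }v}f(e)$. The flux of $f$ is $\operatorname{flux}(f)=\sum_{e\text{ out of }s}f(e)=\sum_{e\text{ into }t}f(e)$. A max flow is a flow obeying (1) and (2) whose flux is maximal. The unoriented case is mapped to the oriented case by replacing each edge $e$ with two oppositely oriented edges $e_+$ and $e_-$ of equal capacity. Flows are regarded as points of the Euclidean space of real-valued functions on the oriented edges, and $K_\tau$ as a closed subset of it; the Hausdorff topology is taken with respect to the sup norm, $\epsilon$-neighborhoods being sup-norm neighborhoods. The parenthetical ''Lipschitz'' refers to the dependence of the set of max flows on the network parameters (the weights). *)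

(* Defs.v *)
From HB Require Import structures.
From mathcomp Require Import all_boot all_order all_algebra.
From mathcomp Require Import all_classical all_reals all_analysis.
From mathcomp Require Import lra.
Set Implicit Arguments.
Unset Strict Implicit.
Unset Printing Implicit Defensive.
Import Order.TTheory GRing.Theory Num.Theory.
Import numFieldNormedType.Exports.
Local Open Scope classical_set_scope.
Local Open Scope ring_scope.

Section Hyperspace.
Context {R : numFieldType}.

Record closed_set (T : pseudoMetricType R) := ClosedSet {
  closed_carrier :> set T;
  closed_carrierP : closed closed_carrier }.

Variable T : pseudoMetricType R.

HB.instance Definition _ := gen_eqMixin (closed_set T).
HB.instance Definition _ := gen_choiceMixin (closed_set T).

(* Each of the two sets lies in the open e-neighborhood of the other. *)
Definition hausdorff_ball (A : closed_set T) (e : R) (B : closed_set T) : Prop :=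
  A `<=` \bigcup_(y in B) ball y e /\ B `<=` \bigcup_(x in A) ball x e.

Lemma hausdorff_ball_center A (e : R) : 0 < e -> hausdorff_ball A e A.
Proof. by move=> e0; split=> x Ax; exists x => //; exact: ballxx. Qed.

Lemma hausdorff_ball_sym A B (e : R) :
  hausdorff_ball A e B -> hausdorff_ball B e A.
Proof. by case. Qed.

Lemma hausdorff_ball_triangle A B C (e1 e2 : R) :
  hausdorff_ball A e1 B -> hausdorff_ball B e2 C ->
  hausdorff_ball A (e1 + e2) C.
Proof.
move=> [AB BA] [BC CB]; split=> x.
  move=> /AB[y By yx]; have [z Cz zy] := BC _ By.
  by exists z => //; rewrite addrC; exact: ball_triangle yx.
move=> /CB[y By yx]; have [z Az zy] := BA _ By.
by exists z => //; exact: ball_triangle yx.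
Qed.

HB.instance Definition _ :=
  hasNbhs.Build (closed_set T) (nbhs_ (entourage_ hausdorff_ball)).

(* The Hausdorff topology on closed subsets, as an extended pseudometric:
   two closed sets may be at infinite distance. *)
HB.instance Definition _ := @Nbhs_isPseudoMetric.Build R (closed_set T)
  (entourage_ hausdorff_ball) erefl hausdorff_ball
  hausdorff_ball_center hausdorff_ball_sym hausdorff_ball_triangle erefl.

End Hyperspace.

Definition hausdorff_dist (R : realType) (T : pseudoMetricType R)
    (A B : closed_set T) : \bar R :=
  ereal_inf [set e%:E | e in [set e : R | 0 < e /\ hausdorff_ball A e B]].

(* Loops and parallel edges are allowed. *)
Record digraph (V : Type) (m : nat) := Digraph {
  src : 'I_m -> V;
  tgt : 'I_m -> V }.

(* The order of the two ends of an edge is only a matter of presentation. *)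
Record ugraph (V : Type) (m : nat) := UGraph {
  end1 : 'I_m -> V;
  end2 : 'I_m -> V }.

(* Edge e becomes e_+ = lshift m e and e_- = rshift m e. *)
Definition oriented_double (V : Type) (m : nat) (G : ugraph V m) :
    digraph V (m + m) :=
  Digraph
    (fun a => match fintype.split a with inl e => end1 G e | inr e => end2 G e end)
    (fun a => match fintype.split a with inl e => end2 G e | inr e => end1 G e end).

Definition double_weight (R : realType) (m : nat) (w : 'rV[R]_m) :
  'rV[R]_(m + m) := row_mx w w.

Section MaxFlow.
Variables (R : realType) (V : finType) (m : nat) (G : digraph V m) (s t : V).
Implicit Types (w f g : 'rV[R]_m) (v : V).

Definition inflow f v : R := \sum_(e < m | tgt G e == v) f 0 e.
Definition outflow f v : R := \sum_(e < m | src G e == v) f 0 e.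

Definition is_flow w f : Prop :=
  (forall e, 0 <= f 0 e <= w 0 e) /\
  (forall v, v != s -> v != t -> inflow f v = outflow f v).

(* Net flux out of s.  Subtracting the inflow makes the flux at s agree with
   the flux at t (flux_sink) also when edges enter s or leave t, as always
   happens in a doubled unoriented graph.  If there are no such edges these are
   the plain sums over the edges out of s and into t
   (flux_outflow, flux_inflow). *)
Definition flux f : R := outflow f s - inflow f s.

Definition max_flows w : set 'rV[R]_m :=
  [set f | is_flow w f /\ forall g, is_flow w g -> flux g <= flux f].

Lemma sum_divergence f : \sum_v (outflow f v - inflow f v) = 0.
Proof.
rewrite big_split sumrN /= /outflow /inflow.
have E (h : 'I_m -> V) : \sum_v \sum_(e < m | h e == v) f 0 e = \sum_e f 0 e.
  by rewrite [RHS](partition_big h xpredT).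
by rewrite !E subrr.
Qed.

Lemma flux_sink w f : is_flow w f -> flux f = inflow f t - outflow f t.
Proof.
move=> [_ div]; have := sum_divergence f.
rewrite (bigD1 s) //= -/(flux f); have [st|st] := eqVneq s t.
  rewrite big1 ?addr0 => [|v vs]; last by rewrite div -?st ?subrr.
  by move=> f0; rewrite f0 -st -opprB -/(flux f) f0 oppr0.
rewrite (bigD1 t) 1?eq_sym //= big1 ?addr0 => [|v /andP[vs vt]].
  by move/eqP; rewrite addr_eq0 opprB => /eqP.
by rewrite div // subrr.
Qed.

Lemma flux_outflow f : (forall e, tgt G e != s) -> flux f = outflow f s.
Proof.
by move=> hs; rewrite /flux /inflow big_pred0 ?subr0// => e; exact/negbTE.
Qed.

Lemma flux_inflow w f : (forall e, src G e != t) -> is_flow w f ->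
  flux f = inflow f t.
Proof.
move=> ht /flux_sink ->.
by rewrite /outflow big_pred0 ?subr0// => e; exact/negbTE.
Qed.

Let continuous_sum (P : pred 'I_m) :
  continuous (fun f : 'rV[R]_m => \sum_(e < m | P e) f 0 e).
Proof.
elim: (index_enum _) => [|e r IH].
  rewrite (_ : (fun _ => _) = fun=> 0); first by move=> f; exact: cst_continuous.
  by apply/funext => f; rewrite big_nil.
case Pe : (P e); last first.
  rewrite (_ : (fun _ => _) = fun f => \sum_(e <- r | P e) f 0 e) //.
  by apply/funext => f; rewrite big_cons Pe.
rewrite (_ : (fun _ => _) = fun f => f 0 e + \sum_(e <- r | P e) f 0 e).
  by move=> f; apply: continuousD; [exact: coord_continuous|exact: IH].
by apply/funext => f; rewrite big_cons Pe.
Qed.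

Let closed_preim (h : 'rV[R]_m -> R) (A : set R) :
  continuous h -> closed A -> closed [set f | A (h f)].
Proof. by move=> /continuous_closedP; apply. Qed.

Lemma continuous_flux : continuous flux.
Proof. by move=> f; apply: continuousB; exact: continuous_sum. Qed.

Lemma closed_flows w : closed [set f | is_flow w f].
Proof.
rewrite (_ : [set f | _] =
  \bigcap_(e in [set: 'I_m])
    ([set f : 'rV[R]_m | 0 <= f 0 e] `&` [set f : 'rV[R]_m | f 0 e <= w 0 e])
  `&` \bigcap_(v in [set v | v != s /\ v != t])
        [set f | inflow f v - outflow f v = 0]); last first.
  apply/seteqP; split=> [f [cap div]|f [cap div]].
    split=> [e _|v [vs vt]] /=; last by rewrite div ?subrr.
    by apply/andP; exact: cap.
  split=> [e|v vs vt]; last by apply/eqP; rewrite -subr_eq0; apply/eqP/div.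
  by apply/andP; exact: cap.
apply: closedI.
  apply: closed_bigI => e _; apply: closedI.
    by apply: (@closed_preim (fun f => f 0 e) [set x | 0 <= x]);
      [exact: coord_continuous|exact: closed_ge].
  by apply: (@closed_preim (fun f => f 0 e) [set x | x <= w 0 e]);
    [exact: coord_continuous|exact: closed_le].
apply: closed_bigI => v _.
apply: (@closed_preim (fun f => inflow f v - outflow f v) [set x | x = 0]);
  last exact: closed_eq.
move=> f.
by apply: continuousB; exact: continuous_sum.
Qed.

Lemma closed_max_flows w : closed (max_flows w).
Proof.
rewrite (_ : max_flows w = [set f | is_flow w f] `&`
  \bigcap_(g in [set g | is_flow w g]) [set f | flux g <= flux f]); last first.
  by apply/seteqP; split=> f [ff fm]; split=> // g; exact: fm.
apply: closedI; first exact: closed_flows.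
apply: closed_bigI => g _.
apply: (@closed_preim flux [set x | flux g <= x]); last exact: closed_ge.
exact: continuous_flux.
Qed.

Lemma max_flows_neq0 w : (forall e, 0 <= w 0 e) -> max_flows w !=set0.
Proof.
move=> w0; have flow0 : is_flow w 0.
  split=> [e|v _ _]; first by rewrite mxE lexx w0.
  by rewrite /inflow /outflow !big1// => e _; rewrite mxE.
have cpt : compact [set f | is_flow w f].
  apply: bounded_closed_compact; last exact: closed_flows.
  exists `|w|; split=> [|M wM f [cap _]]; first exact: num_real.
  rewrite /= (le_trans _ (ltW wM))// /Num.norm /= !mx_normrE.
  apply: bigmax_le => [|[i e] _]; first exact: bigmax_ge_id.
  apply/bigmax_geP; right; exists (i, e) => //=.
  have := cap e; rewrite (ord1 i) => /andP[f0 fw].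
  by rewrite !ger0_norm// w0.
have [] := @EVT_max_rV R _ flux _ _ cpt.
- by exists 0.
- by apply: continuous_subspaceT; exact: continuous_flux.
- by move=> f /set_mem ff fm; exists f; split=> // g gf; exact/fm/mem_set.
Qed.

Lemma convex_max_flows w : convex_set (max_flows w).
Proof.
suff conv (f g : 'rV[R]_m) (p : R) : 0 <= p -> p <= 1 ->
    max_flows w f -> max_flows w g -> max_flows w (p *: f + (1 - p) *: g).
  by move=> f g p /set_mem wf /set_mem wg; apply/mem_set/conv.
move=> p0 p1 [[capf divf] maxf] [[capg divg] maxg].
have convE e : (p *: f + (1 - p) *: g) 0 e = p * f 0 e + (1 - p) * g 0 e.
  by rewrite !mxE.
have sumE (P : pred 'I_m) : \sum_(e < m | P e) (p *: f + (1 - p) *: g) 0 e =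
    p * (\sum_(e < m | P e) f 0 e) + (1 - p) * (\sum_(e < m | P e) g 0 e).
  by rewrite !mulr_sumr -big_split; apply: eq_bigr => e _; exact: convE.
split; first split=> [e|v vs vt].
- have /andP[f0 fw] := capf e; have /andP[g0 gw] := capg e.
  by rewrite convE; apply/andP; split; nra.
- by rewrite /inflow /outflow !sumE -/(inflow f v) -/(inflow g v) divf ?divg.
move=> h hflow; rewrite /flux /inflow /outflow !sumE.
have := maxf h hflow; have := maxg h hflow.
rewrite /flux /inflow /outflow; nra.
Qed.

Definition max_flow_set w : closed_set 'rV[R]_m :=
  ClosedSet (@closed_max_flows w).

End MaxFlow.

(* Main.v *)
Require Import Defs.
From mathcomp Require Import all_boot all_order all_algebra.
From mathcomp Require Import all_classical all_reals all_analysis.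
From mathcomp Require Import lra.
Set Implicit Arguments.
Unset Strict Implicit.
Unset Printing Implicit Defensive.
Import Order.TTheory GRing.Theory Num.Theory.
Import numFieldNormedType.Exports.
Local Open Scope classical_set_scope.
Local Open Scope ring_scope.

(* Given a max flow f for w, let g be the max flow for w' closest to f in l1
   norm.  The difference g - f is conserved away from s and t, hence is a
   circulation once s and t are identified, hence a conformal sum of at most m
   multiples c C of circulations C with entries in {-1, 0, 1}.  Each c is at most
   delta = |w - w'|: otherwise f + (c - delta) C is a flow for w and
   g - (c - delta) C is a flow for w'; if C has positive flux the former beats f,
   and if not the latter is a max flow closer to f than g.  Thus
   |f - g| <= m delta, so m is a Lipschitz constant. *)

(** Take [A] minimal among the nonempty sets with [f @: A] inside [A]: the image is again such a
    set, so it is all of [A], and [f] permutes [A]. *)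
Lemma ex_stable_imset (T : finType) (P : pred T) (f : T -> T) (x : T) :
  P x -> (forall y, P y -> P (f y)) ->
  exists A : {set T},
    [/\ A != finset.set0, {subset A <= P} & (f @: A)%SET = A].
Proof.
move=> Px Pf; pose p (A : {set T}) := (A != finset.set0) && (f @: A \subset A)%SET.
have pC : p [set y | P y]%SET.
  apply/andP; split; first by apply/set0Pn; exists x; rewrite inE.
  by apply/fintype.subsetP => _ /imsetP[y + ->]; rewrite !inE; exact: Pf.
have [A /minsetP[/andP[A0 fA] minA] AC] := minset_exists pC.
exists A; split=> //; first by move=> y /(fintype.subsetP AC); rewrite inE.
apply: minA => //; apply/andP; split; last exact: imsetS.
by have [y Ay] := set0Pn _ A0; apply/set0Pn; exists (f y); exact: imset_f.
Qed.

Section SignVectors.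
Context {R : realType} {V : finType} {m : nat}.
Implicit Types (G : digraph V m) (d f g h w : 'rV[R]_m) (A : {set 'I_m}).

(** * Linearity of inflow, outflow and flux *)

Lemma inflowB G f g v : inflow G (f - g) v = inflow G f v - inflow G g v.
Proof. by rewrite -sumrB; apply: eq_bigr => e _; rewrite !mxE. Qed.

Lemma outflowB G f g v : outflow G (f - g) v = outflow G f v - outflow G g v.
Proof. by rewrite -sumrB; apply: eq_bigr => e _; rewrite !mxE. Qed.

Lemma inflowZ G (a : R) f v : inflow G (a *: f) v = a * inflow G f v.
Proof. by rewrite mulr_sumr; apply: eq_bigr => e _; rewrite !mxE. Qed.

Lemma outflowZ G (a : R) f v : outflow G (a *: f) v = a * outflow G f v.
Proof. by rewrite mulr_sumr; apply: eq_bigr => e _; rewrite !mxE. Qed.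

Lemma fluxB G s f g : flux G s (f - g) = flux G s f - flux G s g.
Proof. by rewrite /flux inflowB outflowB; lra. Qed.

Lemma fluxZ G s (a : R) f : flux G s (a *: f) = a * flux G s f.
Proof. by rewrite /flux inflowZ outflowZ; lra. Qed.

(** * Circulations with entries in {-1, 0, 1} aligned with [d] *)

Definition signs_on A d : 'rV[R]_m :=
  \row_e (if e \in A then Num.sg (d 0 e) else 0).

(** The ends of [e] traversed in the direction in which [d] flows. Edges with [d 0 e = 0] count as
    reversed, harmlessly, since they carry no flow. *)
Definition edge_head G d (e : 'I_m) : V := if 0 < d 0 e then tgt G e else src G e.
Definition edge_tail G d (e : 'I_m) : V := if 0 < d 0 e then src G e else tgt G e.

Lemma inflowE G f v : inflow G f v = \sum_e f 0 e * (tgt G e == v)%:R.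
Proof.
by rewrite /inflow big_mkcond; apply: eq_bigr => e _; case: ifP; rewrite ?mulr1 ?mulr0.
Qed.

Lemma outflowE G f v : outflow G f v = \sum_e f 0 e * (src G e == v)%:R.
Proof.
by rewrite /outflow big_mkcond; apply: eq_bigr => e _; case: ifP; rewrite ?mulr1 ?mulr0.
Qed.

Lemma excessE G d v : inflow G d v - outflow G d v =
  \sum_e `|d 0 e| * ((edge_head G d e == v)%:R - (edge_tail G d e == v)%:R).
Proof.
rewrite inflowE outflowE -sumrB; apply: eq_bigr => e _; rewrite /edge_head /edge_tail.
by case: ltrP => h; rewrite ?(gtr0_norm h) ?(ler0_norm h); lra.
Qed.

Lemma excess_signs_on G A d v : {in A, forall e, d 0 e != 0} ->
  inflow G (signs_on A d) v - outflow G (signs_on A d) v =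
  \sum_(e in A) ((edge_head G d e == v)%:R - (edge_tail G d e == v)%:R).
Proof.
move=> Ad; rewrite inflowE outflowE -sumrB [RHS]big_mkcond.
apply: eq_bigr => e _; rewrite mxE; case: ifP => [eA|_]; last by rewrite !mul0r subrr.
rewrite /edge_head /edge_tail; case: ltrgtP (Ad e eA) => // h _.
  by rewrite gtr0_sg//; lra.
by rewrite ltr0_sg//; lra.
Qed.

(* Follow the edges of the support in the direction of d: the excess vanishes,
   so every head is a tail, and the walk ends up permuting a set of edges. *)
Lemma circulation_signs G d :
  (forall v, inflow G d v = outflow G d v) -> d != 0 ->
  exists A : {set 'I_m},
    [/\ A != finset.set0, {in A, forall e, d 0 e != 0} &
      forall v, inflow G (signs_on A d) v = outflow G (signs_on A d) v].
Proof.
move=> circ /rV0Pn[e0 de0].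
have next e : d 0 e != 0 -> exists e', (d 0 e' != 0) && (edge_tail G d e' == edge_head G d e).
  (* If no support edge left the head of [e], all terms of the excess there would be nonnegative
     with sum 0, yet the term of [e] is [|d 0 e| > 0]. *)
  move=> de; apply/existsP; apply: contraT; rewrite negb_exists => /forallP none.
  have := excessE G d (edge_head G d e); rewrite circ subrr => /esym/eqP.
  rewrite psumr_eq0 => [/allP/(_ e (mem_index_enum _))|e' _].
    rewrite implyTb mulf_eq0 normr_eq0 (negbTE de) eqxx /= => /eqP h.
    by move: (none e) h; rewrite de; case: eqP => //= _ _; lra.
  have := none e'; case: (eqVneq (d 0 e') 0) => [->|_ /= /negbTE ->].
    by rewrite normr0 mul0r.
  by rewrite subr0 mulr_ge0.
(* The default [e] can only be reached off the support. *)
pose nxt e := odflt e [pick e' | (d 0 e' != 0) && (edge_tail G d e' == edge_head G d e)].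
have nxtP e : d 0 e != 0 -> (d 0 (nxt e) != 0) && (edge_tail G d (nxt e) == edge_head G d e).
  by move=> /next[e' he']; rewrite /nxt; case: pickP => //= /(_ e'); rewrite he'.
have [e de|A [A0 Ad nA]] := @ex_stable_imset _ (fun e => d 0 e != 0) nxt _ de0.
  by have /andP[] := nxtP e de.
exists A; split=> // v; apply/eqP; rewrite -subr_eq0 excess_signs_on// sumrB subr_eq0.
(* [nxt] permutes [A], so the tails can be reindexed along it; the tail of [nxt e] is the head of
   [e]. *)
apply/eqP; rewrite -[in RHS]nA big_imset/=.
  by apply: eq_bigr => e /Ad/nxtP/andP[_ /eqP ->].
by apply/imset_injP; rewrite nA.
Qed.

(** * Conservation away from source and sink *)

Definition conserved G (s t : V) d :=
  forall v, v != s -> v != t -> inflow G d v = outflow G d v.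

Definition merge_vertices (s t : V) G : digraph V m :=
  let p v := if v == t then s else v in
  Digraph (fun e => p (src G e)) (fun e => p (tgt G e)).

Lemma merge_flow s t G d v : v != s -> v != t ->
  inflow (merge_vertices s t G) d v = inflow G d v /\
  outflow (merge_vertices s t G) d v = outflow G d v.
Proof.
move=> vs vt.
have E x : ((if x == t then s else x) == v) = (x == v).
  by case: (eqVneq x t) => // ->; rewrite eq_sym (negbTE vs) eq_sym (negbTE vt).
by split; apply: eq_bigl => e; rewrite /= E.
Qed.

(** If [t] differs from [s], no edge of the merged graph touches [t]. At [s], balance follows from
    that at all other vertices, the total divergence being 0. *)
Lemma conserved_merge s t G d : conserved G s t d <->
  forall v, inflow (merge_vertices s t G) d v = outflow (merge_vertices s t G) d v.
Proof.
split=> cons v; last by move=> vs vt; have [<- <-] := merge_flow G d vs vt.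
have off u : u != s ->
    inflow (merge_vertices s t G) d u = outflow (merge_vertices s t G) d u.
  move=> us; have [ut|ut] := eqVneq u t; last first.
    by have [-> ->] := merge_flow G d us ut; exact: cons.
  have E x : ((if x == t then s else x) == u) = false.
    case: (eqVneq x t) => [_|xt]; first by rewrite eq_sym (negbTE us).
    by rewrite ut (negbTE xt).
  by rewrite /inflow /outflow !big_pred0// => e; exact: E.
have [->|] := eqVneq v s; last exact: off.
have := sum_divergence (merge_vertices s t G) d.
rewrite (bigD1 s) //= big1 ?addr0 => [/eqP|u us]; last by rewrite off ?subrr.
by rewrite subr_eq0 => /eqP.
Qed.

Lemma conserved_signs G s t d : conserved G s t d -> d != 0 ->
  exists A : {set 'I_m},
    [/\ A != finset.set0, {in A, forall e, d 0 e != 0} &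
      conserved G s t (signs_on A d)].
Proof.
move=> /conserved_merge circ /(circulation_signs circ)[A [A0 Ad cA]].
by exists A; split=> //; exact/conserved_merge.
Qed.

Lemma conservedB G s t f g :
  conserved G s t f -> conserved G s t g -> conserved G s t (f - g).
Proof. by move=> cf cg v vs vt; rewrite inflowB outflowB cf ?cg. Qed.

Lemma conservedZ G s t (a : R) f : conserved G s t f -> conserved G s t (a *: f).
Proof. by move=> cf v vs vt; rewrite inflowZ outflowZ cf. Qed.

(** * Conformal decomposition and the bound on entries *)

Definition edge_support d := [pred i : 'I_m | d 0 i != 0].

(* Subtracting from d the largest multiple of a sign vector below d removes an
   edge from the support, so d is a sum of at most m such multiples. *)
Lemma conserved_norm_le G s t d (delta : R) : conserved G s t d ->
  (forall A (c : R), A != finset.set0 -> conserved G s t (signs_on A d) -> 0 < c ->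
    {in A, forall e, c <= `|d 0 e|} -> c <= delta) ->
  forall e, `|d 0 e| <= #|edge_support d|%:R * delta.
Proof.
have [n] := ubnP #|edge_support d|.
elim: n d => // n IH d dn cons bound e.
have [->|d0] := eqVneq d 0.
  rewrite mxE normr0 eq_card0 ?mul0r// => i; by rewrite !inE mxE eqxx.
have [A [A0 Ad cA]] := conserved_signs cons d0.
have [e0 e0A] := set0Pn _ A0.
have [e1 e1A minA] := @arg_minP _ _ _ e0 (fun i => i \in A) (fun i => `|d 0 i|) e0A.
pose c : R := `|d 0 e1|; pose d' : 'rV[R]_m := d - c *: signs_on A d.
have c0 : 0 < c by rewrite normr_gt0 Ad.
have cdelta : c <= delta by apply: bound cA c0 _ => // i /minA.
have d'E i : d' 0 i = Num.sg (d 0 i) * (`|d 0 i| - (if i \in A then c else 0)).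
  rewrite !mxE mulrBr -numEsg; case: ifP => _; last by rewrite !mulr0.
  by rewrite (mulrC c).
have le_d i : (if i \in A then c else 0) <= `|d 0 i|.
  by case: ifP => // /minA.
have d'N i : d 0 i != 0 -> `|d' 0 i| = `|d 0 i| - (if i \in A then c else 0).
  by move=> di; rewrite d'E normrM normr_sg di mul1r ger0_norm// subr_ge0.
have d'S i : d' 0 i != 0 -> d 0 i != 0.
  by apply: contraNneq => di; rewrite d'E di sgr0 mul0r.
have d'sg i : d' 0 i != 0 -> Num.sg (d' 0 i) = Num.sg (d 0 i).
  move=> d'i; rewrite d'E sgrM sgr_id [X in _ * X]gtr0_sg ?mulr1//.
  by rewrite -d'N ?d'S// normr_gt0.
have supp : (#|edge_support d'| < #|edge_support d|)%N.
  apply: proper_card; apply/properP; split.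
    by apply/fintype.subsetP => i; rewrite !inE; exact: d'S.
  exists e1; rewrite !inE ?Ad// negbK -normr_eq0 d'N ?Ad//.
  by rewrite e1A subrr.
have d'e j : `|d' 0 j| <= (#|edge_support d'|)%:R * delta.
  apply: IH => [||B k B0 cB k0 kB].
  - exact: leq_trans supp _.
  - by apply: conservedB => //; exact: conservedZ.
  have Bd' i : i \in B -> d' 0 i != 0 by move=> /kB; rewrite -normr_gt0; exact: lt_le_trans.
  (* On its support [d'] has the signs of [d], and its entries are no larger in absolute value, so
     the bound for [d] applies to sign vectors below [d']. *)
  apply: (bound B k) => // [|i iB].
    have -> // : signs_on B d = signs_on B d'.
    apply/rowP => i; rewrite [LHS]mxE [RHS]mxE.
    by case: ifP => // /Bd'/d'sg.
  rewrite (le_trans (kB i iB))// d'N ?d'S ?Bd'//.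
  by rewrite gerBl; case: ifP => // _; exact: ltW.
have delta0 : 0 <= delta by exact: le_trans (ltW c0) cdelta.
(* The edge lost from the support pays for the amount [c <= delta] removed from an entry. *)
have : (#|edge_support d'|.+1)%:R * delta <= #|edge_support d|%:R * delta.
  by rewrite ler_wpM2r// ler_nat.
apply: le_trans; rewrite -natr1 mulrDl mul1r.
have [de|de] := eqVneq (d 0 e) 0.
  by rewrite de normr0 addr_ge0// mulr_ge0.
have := d'e e; rewrite d'N//; case: ifP => _; lra.
Qed.


(** * Sup norm, compactness and nearest max flows *)

Lemma row_entry_norm_le d e : `|d 0 e| <= `|d|.
Proof.
rewrite [leRHS]/Num.norm /= mx_normrE.
by apply/bigmax_geP; right; exists (0, e).
Qed.

Lemma row_norm_le d (c : R) : 0 <= c -> (forall e, `|d 0 e| <= c) -> `|d| <= c.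
Proof.
move=> c0 dc; rewrite /Num.norm /= mx_normrE.
by apply: bigmax_le => // -[i e] _ /=; rewrite ord1.
Qed.

Lemma compact_max_flows G s t w : compact (max_flows G s t w).
Proof.
apply: bounded_closed_compact; last exact: closed_max_flows.
exists `|w|; split=> [|M wM f [[cap _] _]]; first exact: num_real.
apply: (le_trans _ (ltW wM)); apply: row_norm_le => // e.
have /andP[f0 fw] := cap e; rewrite ger0_norm// (le_trans fw)//.
exact: le_trans (ler_norm _) (row_entry_norm_le w e).
Qed.

Lemma continuous_edge_dist f e : continuous (fun h => `|(h - f) 0 e|).
Proof.
have -> : (fun h => `|(h - f) 0 e|) = (fun h => `|h 0 e - f 0 e|).
  by apply/funext => h; rewrite !mxE.
move=> h; apply: (continuous_comp (f := fun k : 'rV[R]_m => k 0 e - f 0 e)).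
  by apply: continuousB; [exact: coord_continuous|exact: cst_continuous].
exact: norm_continuous.
Qed.

(* The l1 distance, unlike the sup norm, strictly decreases as soon as one
   coordinate of h moves towards f and the others do not move away. *)
Lemma nearest_max_flow G s t w f : (forall e, 0 <= w 0 e) ->
  exists2 g, max_flows G s t w g &
    forall h, max_flows G s t w h ->
      \sum_e `|(g - f) 0 e| <= \sum_e `|(h - f) 0 e|.
Proof.
move=> w0.
have [|g /set_mem gmax gmin] := @EVT_min_rV R _ (fun h => \sum_e `|(h - f) 0 e|) _
  (max_flows_neq0 G s t w0) (@compact_max_flows G s t w).
  apply: continuous_subspaceT; apply: continuous_big => [|e _].
    exact: add_continuous.
  exact: continuous_edge_dist.
by exists g => // h /mem_set; exact: gmin.
Qed.

(** * The Lipschitz estimate *)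

Lemma max_flow_nearby G s t w w' f : (forall e, 0 <= w' 0 e) ->
  max_flows G s t w f ->
  exists2 g, max_flows G s t w' g & `|f - g| <= m%:R * `|w - w'|.
Proof.
move=> w'0 [[capf consf] maxf].
have [g gmax gmin] := nearest_max_flow G s t f w'0.
have [[capg consg] maxg] := gmax.
exists g => //; apply: row_norm_le => [|e]; first by rewrite mulr_ge0.
have cons : conserved G s t (g - f) by exact: conservedB.
have ww' i : `|w 0 i - w' 0 i| <= `|w - w'|.
  by have := row_entry_norm_le (w - w') i; rewrite !mxE.
have -> : `|(f - g) 0 e| = `|(g - f) 0 e| by rewrite !mxE distrC.
apply: le_trans (conserved_norm_le (delta := `|w - w'|) cons _ e) _; last first.
  by rewrite ler_wpM2r// ler_nat -[leqRHS]card_ord max_card.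
move=> A c /set0Pn[e0 e0A] consA c0 cA; rewrite leNgt; apply/negP => wc.
pose h (a : R) (k : 'rV[R]_m) := k - a *: signs_on A (g - f).
have hE a k i : h a k 0 i =
    k 0 i - a * (if i \in A then Num.sg (g 0 i - f 0 i) else 0).
  by rewrite !mxE.
have cAE i : i \in A -> c <= `|g 0 i - f 0 i| by move=> /cA; rewrite !mxE.
have consh a k : conserved G s t k -> conserved G s t (h a k).
  by move=> ck; apply: conservedB => //; exact: conservedZ.
have [fluxA|fluxA] := ltP 0 (flux G s (signs_on A (g - f))).
  have : flux G s (h (`|w - w'| - c) f) <= flux G s f.
    (* Where the sign is 1, [f + c <= g <= w' <= w + |w - w'|] at [i]; where it is -1,
       [f - c >= g >= 0]. The check for [g] below is symmetric. *)
    apply: maxf; split=> [i|]; last exact: consh.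
    have := ww' i; rewrite ler_norml => /andP[wi1 wi2].
    have /andP[fi1 fi2] := capf i; have /andP[gi1 gi2] := capg i.
    rewrite hE; case: ifP => [iA|_]; last by rewrite mulr0 subr0 fi1.
    have := cAE i iA; case: (ltrgtP (g 0 i - f 0 i) 0) => di.
    - by rewrite ltr0_sg// ltr0_norm// => ci; apply/andP; split; lra.
    - by rewrite gtr0_sg// gtr0_norm// => ci; apply/andP; split; lra.
    - by rewrite di normr0; lra.
  rewrite fluxB fluxZ; nra.
have hmax : max_flows G s t w' (h (c - `|w - w'|) g).
  split; first split=> [i|]; last first.
  - move=> k /maxg/le_trans; apply; rewrite fluxB fluxZ; nra.
  - exact: consh.
  have := ww' i; rewrite ler_norml => /andP[wi1 wi2].
  have /andP[fi1 fi2] := capf i; have /andP[gi1 gi2] := capg i.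
  rewrite hE; case: ifP => [iA|_]; last by rewrite mulr0 subr0 gi1.
  have := cAE i iA; case: (ltrgtP (g 0 i - f 0 i) 0) => di.
  - by rewrite ltr0_sg// ltr0_norm// => ci; apply/andP; split; lra.
  - by rewrite gtr0_sg// gtr0_norm// => ci; apply/andP; split; lra.
  - by rewrite di normr0; lra.
have := gmin _ hmax; apply/negP; rewrite -ltNge.
(* Since [0 < c - |w - w'| <= c <= |g - f|] at [i], the shift moves [g] strictly towards [f] without
   overshooting. *)
have closer i : i \in A -> `|(h (c - `|w - w'|) g - f) 0 i| < `|(g - f) 0 i|.
  move=> iA; have := cAE i iA; have := normr_ge0 (w - w').
  rewrite [X in `|X| < _](_ : _ = h (c - `|w - w'|) g 0 i - f 0 i); last by rewrite !mxE.
  rewrite hE iA [(g - f) 0 i](_ : _ = g 0 i - f 0 i); last by rewrite !mxE.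
  case: (ltrgtP (g 0 i - f 0 i) 0) => di.
  - by rewrite ltr0_sg// ltr0_norm// => w0 ci; rewrite ler0_norm; lra.
  - by rewrite gtr0_sg// gtr0_norm// => w0 ci; rewrite ger0_norm; lra.
  - by rewrite di normr0; lra.
rewrite (bigD1 e0) //= [ltRHS](bigD1 e0) //=; apply: ltr_leD; first exact: closer.
apply: ler_sum => i _; have [/closer/ltW//|iA] := boolP (i \in A).
by rewrite !mxE (negbTE iA) mulr0 subr0.
Qed.

(** * From nearby max flows to the Hausdorff topology *)

Lemma hausdorff_ball_max_flow G s t w w' (r : R) :
  (forall e, 0 <= w 0 e) -> (forall e, 0 <= w' 0 e) ->
  m%:R * `|w - w'| < r ->
  hausdorff_ball (max_flow_set G s t w) r (max_flow_set G s t w').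
Proof.
move=> w0 w'0 wr; split=> f.
  move=> /(max_flow_nearby w'0)[g gmax fg]; exists g => //.
  by rewrite mx_norm_ball /ball_/= distrC (le_lt_trans fg).
move=> /(max_flow_nearby w0)[g gmax fg]; exists g => //.
by rewrite mx_norm_ball /ball_/= distrC (le_lt_trans fg)// (distrC w').
Qed.

Lemma hausdorff_dist_max_flow G s t w w' :
  (forall e, 0 <= w 0 e) -> (forall e, 0 <= w' 0 e) ->
  (hausdorff_dist (max_flow_set G s t w) (max_flow_set G s t w')
    <= (m%:R * `|w - w'|)%:E)%E.
Proof.
(* Balls are open, so the radius needs a slack [r] above [m |w - w'|]. *)
move=> w0 w'0; apply/lee_addgt0Pr => r r0; apply: ereal_inf_lbound.
exists (m%:R * `|w - w'| + r) => //; split.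
  by rewrite ltr_wpDl// mulr_ge0.
by apply: hausdorff_ball_max_flow => //; rewrite ltrDl.
Qed.

Lemma continuous_max_flow_set G s t (w : R -> 'rV[R]_m) :
  (forall tau e, 0 <= w tau 0 e) -> (forall e, continuous (fun tau => w tau 0 e)) ->
  continuous (fun tau => max_flow_set G s t (w tau)).
Proof.
move=> w0 cw tau; apply/cvg_ballP => r r0.
(* Dividing by [m + 1] rather than [m] covers [m = 0] and makes [m |w tau - w x| < r] strict. *)
have d0 : 0 < r / m.+1%:R by rewrite divr_gt0.
have near_w : \forall x \near tau, forall e, `|w tau 0 e - w x 0 e| < r / m.+1%:R.
  have near_we e : \forall x \near tau, `|w tau 0 e - w x 0 e| < r / m.+1%:R.
    by have /cvgrPdist_lt := cw e tau; apply.
  exact: filter_forall (nbhs_filter tau) near_we.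
apply: filterS near_w => x wx; apply: hausdorff_ball_max_flow => //.
have : `|w tau - w x| <= r / m.+1%:R.
  by apply: row_norm_le => [|e]; [exact: ltW|rewrite !mxE; exact/ltW].
rewrite ler_pdivlMr// -natr1 => H.
have [->|n0] := eqVneq `|w tau - w x| 0; first by rewrite mulr0.
have : 0 < `|w tau - w x| by rewrite lt0r n0 normr_ge0.
by move: H; rewrite mulrDr mulr1 mulrC; lra.
Qed.

End SignVectors.

Theorem lemmaA2 (R : realType) (V : finType) (m : nat) (s t : V) :
  (forall G : digraph V m,
    (exists2 L : R, 0 <= L &
      forall w w' : 'rV[R]_m,
        (forall i, 0 <= w 0 i) -> (forall i, 0 <= w' 0 i) ->
        (hausdorff_dist (max_flow_set G s t w) (max_flow_set G s t w')
          <= (L * `|w - w'|)%:E)%E) /\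
    (forall w : 'I_m -> R -> R,
        (forall i tau, 0 <= w i tau) -> (forall i, continuous (w i)) ->
        continuous (fun tau : R => max_flow_set G s t (\row_i w i tau)))) /\
  (forall G : ugraph V m,
    (exists2 L : R, 0 <= L &
      forall w w' : 'rV[R]_m,
        (forall i, 0 <= w 0 i) -> (forall i, 0 <= w' 0 i) ->
        (hausdorff_dist
            (max_flow_set (oriented_double G) s t (double_weight w))
            (max_flow_set (oriented_double G) s t (double_weight w'))
          <= (L * `|w - w'|)%:E)%E) /\
    (forall w : 'I_m -> R -> R,
        (forall i tau, 0 <= w i tau) -> (forall i, continuous (w i)) ->
        continuous (fun tau : R =>
          max_flow_set (oriented_double G) s t
            (double_weight (\row_i w i tau))))).
Proof.
(* Each oriented edge carries the weight of one original edge, so nonnegativity, continuity and norm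
   bounds pass to the doubled weights. *)
have doubleE e : exists i, forall w : 'rV[R]_m, double_weight w 0 e = w 0 i.
  rewrite /double_weight; case E : (fintype.split e) => [i|i]; exists i => w;
  by rewrite mxE E.
split=> G; split.
- by exists m%:R => // w w'; exact: hausdorff_dist_max_flow.
- move=> w w0 cw; apply: continuous_max_flow_set => [tau e|e]; first by rewrite mxE.
  by under eq_fun do rewrite mxE; exact: cw.
(* The constant is the number of oriented edges; doubling does not increase the sup norm of
   [w - w']. *)
- exists (m + m)%:R => // w w' w0 w'0.
  apply: le_trans (hausdorff_dist_max_flow _ _ _ _ _) _ => [e|e|].
  + by have [i ->] := doubleE e.
  + by have [i ->] := doubleE e.
  rewrite lee_fin ler_wpM2l//; apply: row_norm_le => // e.
  have [i Ei] := doubleE e.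
  rewrite /double_weight opp_row_mx add_row_mx -/(double_weight (w - w')) Ei.
  exact: row_entry_norm_le.
- move=> w w0 cw; apply: continuous_max_flow_set => [tau e|e].
    by have [i ->] := doubleE e; rewrite mxE.
  have [i Ei] := doubleE e.
  by under eq_fun do rewrite Ei mxE; exact: cw.
Qed.
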